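(* Let $p$ be a prime, $q=p^l$, $m\ge1$, $n=2m$. Let $r=\rho(q-1)$ with $0\leqslant\rho\leqslant n-1$ and $\rho=2\rho'$ even, and let $I\subseteq M_r$ with $\{0,2\}\cap I=\{0\}$. Then the minimum weight codewords of $\mathcal{C}_q(r,I,n)$ are exactly the vectors $x=(x_g)_{g\in\mathbb{F}_{q^n}}$ for which there exist $\lambda\in\mathbb{F}_q^*$, $h\in\mathbb{F}_{q^n}$ and an $\mathbb{F}_{q^2}$-subspace $V\subseteq\mathbb{F}_{q^n}$ of dimension $m-\rho'$ over $\mathbb{F}_{q^2}$ such that $x_g=\lambda$ for $g\in h+V$ and $x_g=0$ otherwise.
   Context: Let $N=q^n-1$ and $\alpha$ a primitive element of $\mathbb{F}_{q^n}$. Every integer $0\le u\le q^n-1$ is written $u=\sum_{i=0}^{n-1}u_iq^i$, $u_i\in\{0,\dots,q-1\}$; $\mathrm{wt}_q(u)=\sum u_i$, $O(u)=\sum_{i\text{ odd}}u_i$, $E(u)=\sum_{i\text{ even}}u_i$. For $-1\le r<n(q-1)$, $Z_r=\{\alpha^u\mid 0<u\le q^n-1,\ \mathrm{wt}_q(u)\le n(q-1)-r-1\}$. For $0\le r\le n(q-1)$ and integer $k\ge0$, $\Theta^{(r)}_k=\{\alpha^u\mid 0\le u\le q^n-1,\ \mathrm{wt}_q(u)=n(q-1)-r,\ |O(u)-E(u)|=k\}$. $M_r$ is the set of even (resp. odd) integers $k\in[0,m(q-1)]$ when $r$ is even (resp. odd). For $I\subseteq M_r$: $\overline I=M_r\setminus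 I$, $Z_{r,I}=Z_r\cup\bigcup_{k\in\overline I}\Theta^{(r)}_k$. $\mathcal{C}_q(r,I,n)^*$ is the cyclic code of length $N$ with coordinates indexed by $\mathbb{F}_{q^n}^*$ consisting of all $x=(x_g)$ with $\sum_g x_g g^{u}=0$ for every $u\in[1,N]$ with $\alpha^u\in Z_{r,I}$. $\mathcal{C}_q(r,I,n)$ is its extended code, with coordinates indexed by $\mathbb{F}_{q^n}$: a codeword $x$ of $\mathcal{C}_q(r,I,n)^*$ is extended by the coordinate $x_0=-\sum_{g\ne0}x_g$. Minimum weight is Hamming weight. *)

(* Defs.v *)
From mathcomp Require Import all_boot all_order all_algebra all_field.
Set Implicit Arguments. Unset Strict Implicit. Unset Printing Implicit Defensive.
Import GRing.Theory.
Local Open Scope ring_scope.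

Section Codes.
Variable F : finFieldType.

Definition digit (q i u : nat) : nat := (u %/ q ^ i %% q)%N.
Definition wtq (q n u : nat) : nat := (\sum_(i < n) digit q i u)%N.
Definition Oq (q n u : nat) : nat := (\sum_(i < n | odd i) digit q i u)%N.
Definition Eq (q n u : nat) : nat := (\sum_(i < n | ~~ odd i) digit q i u)%N.
Definition absOE (q n u : nat) : nat := (Oq q n u - Eq q n u + (Eq q n u - Oq q n u))%N.

Definition Mr (q m r k : nat) : bool := (k <= m * (q - 1))%N && (odd k == odd r).

Definition Zr (q n : nat) (alpha : F) (r : nat) : {set F} :=
  [set alpha ^+ (val u) | u : 'I_(q ^ n)
     & (0 < val u)%N && (wtq q n (val u) <= n * (q - 1) - r - 1)%N].

Definition Theta (q n : nat) (alpha : F) (r k : nat) : {set F} :=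
  [set alpha ^+ (val u) | u : 'I_(q ^ n)
     & (wtq q n (val u) == n * (q - 1) - r)%N && (absOE q n (val u) == k)].

Definition ZrI (q m : nat) (alpha : F) (r : nat) (I : pred nat) : {set F} :=
  Zr q (2 * m) alpha r :|:
  \bigcup_(k < (m * (q - 1)).+1 | Mr q m r k && ~~ I k) Theta q (2 * m) alpha r k.

Definition Fsub (q : nat) : pred F := [pred a : F | a ^+ q == a].

Definition in_Cstar (q m : nat) (alpha : F) (r : nat) (I : pred nat) (x : F -> F) : Prop :=
  (forall g : F, g != 0 -> x g \in Fsub q) /\
  (forall u : nat, (1 <= u <= (q ^ (2 * m)).-1)%N -> alpha ^+ u \in ZrI q m alpha r I ->
      \sum_(g : F | g != 0) x g * g ^+ u = 0).

(* codewords of the extended code C_q(r,I,n), indexed by F *)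
Definition in_C (q m : nat) (alpha : F) (r : nat) (I : pred nat) (x : F -> F) : Prop :=
  in_Cstar q m alpha r I x /\ x 0 = - \sum_(g : F | g != 0) x g.

Definition hwt (x : F -> F) : nat := #|[set g : F | x g != 0]|.

Definition min_wt_codeword (q m : nat) (alpha : F) (r : nat) (I : pred nat) (x : F -> F) : Prop :=
  [/\ in_C q m alpha r I x, (exists g, x g != 0) &
      forall y : F -> F, in_C q m alpha r I y -> (exists g, y g != 0) -> (hwt x <= hwt y)%N].

Definition subspace_of_dim (K : pred F) (d : nat) (V : {set F}) : Prop :=
  exists b : 'I_d -> F,
    (forall c c' : 'I_d -> F, (forall i, c i \in K) -> (forall i, c' i \in K) ->
        \sum_(i < d) c i * b i = \sum_(i < d) c' i * b i -> forall i, c i = c' i) /\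
    (forall v : F, v \in V <-> exists c : 'I_d -> F,
        (forall i, c i \in K) /\ v = \sum_(i < d) c i * b i).

End Codes.

(* Main.v *)
(* With Q = q^2, d = m - rho' and D = Q^d, every u <= D - 2 has wt_q(u) < 2d(q - 1), so
   the first D - 1 moments s_u = sum_g x_g g^u of a codeword vanish and its weight is at
   least D (Vandermonde).  If the weight is D, the locator f = prod_(g in supp x) (X - g)
   gives a recursion for the s_u.  For 0 < t < D the exponent u = D - 1 + t has smaller
   weight than 2d(q - 1), or lies in Theta_2, unless t = D - Q^i; since 2 is not in I,
   the recursion forces f = X^D + sum_(i < d) f_(Q^i) X^(Q^i) + f_0.  Hence the support is
   a coset of an F_Q-subspace, and as f' is constant, so is x on its support.
   Conversely, the locator of a coset of an F_Q-subspace has this shape, Lagrange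
   interpolation kills the moments up to D - 2, and the relation f(g) = 0 with its
   Frobenius powers reduces every other exponent to these, or to u = D - 1, without
   increasing the weight; E(u) and O(u) are unchanged unless the weight drops, and
   E(D - 1) = O(D - 1). *)

Require Import Defs.
From mathcomp Require Import all_boot all_order all_algebra all_field.
From mathcomp Require Import zify.
Set Implicit Arguments. Unset Strict Implicit. Unset Printing Implicit Defensive.
Import GRing.Theory.
Local Open Scope ring_scope.

(** * Base-[q] digits *)

Lemma digit_succ (q i u : nat) : digit q i.+1 u = digit q i (u %/ q)%N.
Proof. by rewrite /digit expnS divnMA. Qed.

(** Removing the lowest digit shifts all positions by one and so exchanges the two parities; the
    inductions on digits below rest on this. *)
Lemma Eq_succ (q n u : nat) : Eq q n.+1 u = (u %% q + Oq q n (u %/ q))%N.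
Proof.
rewrite /Eq /Oq big_mkcond big_ord_recl /= {1}/digit expn0 divn1; congr addn.
rewrite [RHS]big_mkcond; apply: eq_bigr => i _.
by rewrite /= negbK digit_succ.
Qed.

Lemma Oq_succ (q n u : nat) : Oq q n.+1 u = Eq q n (u %/ q).
Proof.
rewrite /Eq /Oq big_mkcond big_ord_recl /= add0n [RHS]big_mkcond.
by apply: eq_bigr => i _; rewrite digit_succ.
Qed.

Lemma wtqE (q n u : nat) : wtq q n u = (Eq q n u + Oq q n u)%N.
Proof.
rewrite /wtq /Eq /Oq (bigID (fun i : 'I_n => ~~ odd i)) /=; congr addn.
by apply: eq_bigl => i; rewrite negbK.
Qed.

Lemma EO0 (q n : nat) : Eq q n 0 = 0%N /\ Oq q n 0 = 0%N.
Proof. by rewrite /Eq /Oq !big1 // => i _; rewrite /digit div0n mod0n. Qed.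

Section Digits.
Variable q : nat.
Hypothesis q_gt1 : (1 < q)%N.

(* Either there is no carry, or a carry brings the digit sum down by [q - 1]. *)
Lemma EO_addX (n j a : nat) :
  (Eq q n (a + q ^ j) = Eq q n a + ~~ odd j /\
   Oq q n (a + q ^ j) = Oq q n a + odd j)%N \/
  (wtq q n (a + q ^ j) <= wtq q n a)%N.
Proof.
elim: n j a => [|n IHn] j a; first by right; rewrite /wtq !big_ord0.
rewrite !wtqE !Eq_succ !Oq_succ.
case: j => [|j].
  have [lt_aq|ge_aq] := ltnP (a %% q).+1 q.
    left; have -> : (a + q ^ 0 = a %/ q * q + (a %% q).+1)%N.
      by rewrite addnS -divn_eq expn0 addn1.
    rewrite modnMDl divnMDl ?(ltnW q_gt1) // (modn_small lt_aq) (divn_small lt_aq).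
    by rewrite /= !addn0; split=> //; lia.
  have eq_aq : (a %% q).+1 = q.
    by apply/eqP; rewrite eqn_leq ge_aq andbT ltn_mod; lia.
  have -> : (a + q ^ 0 = (a %/ q).+1 * q)%N.
    by rewrite expn0 addn1 {1}(divn_eq a q) -addnS eq_aq mulSn addnC.
  rewrite modnMl mulnK ?(ltnW q_gt1) //; right.
  by case: (IHn 0%N (a %/ q)%N); rewrite expn0 addn1 ?wtqE /=; lia.
have -> : ((a + q ^ j.+1) %% q = a %% q)%N.
  by rewrite expnS mulnC addnC modnMDl.
have -> : ((a + q ^ j.+1) %/ q = a %/ q + q ^ j)%N.
  by rewrite expnS mulnC addnC divnMDl ?(ltnW q_gt1) // addnC.
by case: (IHn j (a %/ q)%N); rewrite ?wtqE /=; [left; lia | right; lia].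
Qed.

(** The digit decremented is the lowest nonzero one in a position [j >= k], so no borrow occurs and
    only the sum of that parity changes. *)
Lemma EO_split (n k u : nat) : (q ^ k <= u < q ^ n)%N ->
  exists j u', [/\ (k <= j < n)%N, u = (u' + q ^ j)%N,
    Eq q n u = (Eq q n u' + ~~ odd j)%N & Oq q n u = (Oq q n u' + odd j)%N].
Proof.
have q_gt0 : (0 < q)%N := ltnW q_gt1.
elim: n k u => [|n IHn] k u /andP[le_ku lt_un].
  by have := leq_ltn_trans le_ku lt_un; rewrite expn0 ltnS leqn0 expn_eq0; lia.
have le_uqn : (u %/ q < q ^ n)%N by rewrite ltn_divLR // mulnC -expnS.
have step : (q ^ k.-1 <= u %/ q)%N -> exists j u', [/\ (k <= j < n.+1)%N,
  u = (u' + q ^ j)%N, Eq q n.+1 u = (Eq q n.+1 u' + ~~ odd j)%N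
  & Oq q n.+1 u = (Oq q n.+1 u' + odd j)%N].
  move=> le_kq; have [|j [u' [le_kj def_u defE defO]]] := IHn k.-1 (u %/ q)%N.
    by rewrite le_kq.
  exists j.+1, (u' * q + u %% q)%N.
  rewrite !Eq_succ !Oq_succ modnMDl divnMDl // modn_mod.
  rewrite (divn_small (ltn_pmod _ q_gt0)) addn0 defE defO /= negbK.
  split; [lia | | lia | by []].
  by rewrite {1}(divn_eq u q) def_u expnS mulnDl (mulnC q); lia.
have [k0|k_gt0] := posnP k; last first.
  by apply: step; rewrite leq_divRL // mulnC -expnS prednK.
have [u0|u_gt0] := posnP (u %% q)%N.
  apply: step; rewrite k0 leq_divRL // mul1n.
  rewrite k0 expn0 in le_ku; apply: dvdn_leq => //; exact/eqP.
have lt_uq : ((u %% q).-1 < q)%N by have := ltn_pmod u q_gt0; lia.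
exists 0%N, (u %/ q * q + (u %% q).-1)%N; rewrite k0 !Eq_succ !Oq_succ.
rewrite modnMDl divnMDl // (modn_small lt_uq) (divn_small lt_uq) /= !addn0.
by split=> //; [rewrite {1}(divn_eq u q) expn0 |]; lia.
Qed.

Lemma wtq_gt0 (n u : nat) : (0 < u < q ^ n)%N -> (0 < wtq q n u)%N.
Proof.
by case/(@EO_split n 0 u) => j [u' [_ _ defE defO]]; rewrite wtqE; lia.
Qed.

(** Since [u + v = q ^ k - 1], the digits of [u] and [v] in each position below [k] add up to
    [q - 1]; [uphalf k] of these positions are even and [k./2] are odd. *)
Lemma EO_compl (n k u v : nat) : (k <= n)%N -> (u + v).+1 = (q ^ k)%N ->
  (Eq q n u + Eq q n v = uphalf k * (q - 1) /\
   Oq q n u + Oq q n v = k./2 * (q - 1))%N.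
Proof.
have q_gt0 : (0 < q)%N := ltnW q_gt1.
elim: n k u v => [|n IHn] [|k] u v // le_kn; rewrite ?expn0 => def_uv.
- by rewrite /Eq /Oq !big_ord0.
- have [-> ->] : u = 0%N /\ v = 0%N by lia.
  by rewrite !Eq_succ !Oq_succ mod0n div0n; have := IHn 0%N 0%N 0%N isT (erefl _); lia.
have lt_uq := ltn_pmod u q_gt0; have lt_vq := ltn_pmod v q_gt0.
have def_uvq : ((u %/ q + v %/ q) * q + (u %% q + v %% q).+1 = q ^ k * q)%N.
  by rewrite (mulnC (q ^ k)%N) -expnS -def_uv mulnDl addnS addnACA -!divn_eq.
(* The left side is a positive multiple of [q] and at most [2 * q - 1]. *)
have mod_uv : (u %% q + v %% q).+1 = q.
  have : (q %| (u %% q + v %% q).+1)%N.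
    by rewrite -(dvdn_addr _ (dvdn_mull (u %/ q + v %/ q) (dvdnn q))) def_uvq dvdn_mull.
  case/dvdnP=> [[|[|c]]]; first by [].
    by rewrite mul1n.
  by rewrite !mulSn; lia.
have div_uv : (u %/ q + v %/ q).+1 = (q ^ k)%N.
  by apply/eqP; rewrite -(eqn_pmul2r q_gt0) -def_uvq mod_uv mulSn addnC.
have [defE defO] := IHn k _ _ le_kn div_uv.
rewrite !Eq_succ !Oq_succ /= uphalfE in defE defO *.
by rewrite mulSn; lia.
Qed.

(** The complement of [u] in [q ^ k - 1] is positive, and its digit sum is what [u] lacks to reach
    [k * (q - 1)]. *)
Lemma wtq_lt (n k u : nat) : (k <= n)%N -> (u < (q ^ k).-1)%N ->
  (wtq q n u < k * (q - 1))%N.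
Proof.
move=> le_kn lt_uk; have lt_kn : (q ^ k <= q ^ n)%N by rewrite leq_exp2l.
have [|defE defO] := @EO_compl n k u ((q ^ k).-1 - u)%N le_kn; first by lia.
have := @wtq_gt0 n ((q ^ k).-1 - u)%N; rewrite !wtqE => wt_gt0.
have {}wt_gt0 := wt_gt0 ltac:(lia).
have -> : (k * (q - 1) = uphalf k * (q - 1) + k./2 * (q - 1))%N.
  by rewrite -mulnDl; congr muln; lia.
lia.
Qed.

(* Write [D = q ^ (2d)] and [t = D - v], so that [u = D + (D - 1 - v)].  If [v] has
   digit sum 1 it is a power of [q], with odd exponent by hypothesis; then
   [Eq u = d (q - 1) + 1] and [Oq u = d (q - 1) - 1]. *)
Lemma wtq_second_window (n d t : nat) : (2 * d < n)%N ->
    (0 < t < q ^ (2 * d))%N ->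
    (forall i, (i < d)%N -> t != (q ^ (2 * d) - (q ^ 2) ^ i)%N) ->
  let u := ((q ^ (2 * d)).-1 + t)%N in
  (wtq q n u < 2 * d * (q - 1))%N \/
  wtq q n u = (2 * d * (q - 1))%N /\ absOE q n u = 2.
Proof.
have [k Dk] : {k | k = (2 * d)%N} by exists (2 * d)%N.
have kE : (k * (q - 1) = d * (q - 1) + d * (q - 1))%N by rewrite Dk mul2n -addnn mulnDl.
have [hkE hkO ok] : [/\ uphalf k = d, k./2 = d & odd k = false] by split; lia.
rewrite -Dk => lt_kn t_bd tNQ u.
have leX_kn : (q ^ k <= q ^ n)%N by rewrite leq_exp2l // ltnW.
have [|defE defO] := @EO_compl n k t.-1 (q ^ k - t)%N (ltnW lt_kn); first by lia.
have [|j [v [j_bd def_v vE vO]]] := @EO_split n 0 (q ^ k - t)%N.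
  by rewrite expn0; lia.
rewrite hkE hkO in defE defO.
have -> : u = (t.-1 + q ^ k)%N by rewrite /u; lia.
have [[uE uO]|] := @EO_addX n k t.-1; last first.
  move=> le_u; left; move: le_u; rewrite !wtqE; case: (odd j) vE vO => /=; lia.
rewrite /absOE !wtqE uE uO ok /=.
(* Here [q ^ k - t = v + q ^ j]. If [v] is positive, this number has digit sum at least 2, while
   adding [q ^ k] to [t.-1] raises the weight by only 1. *)
have [v0|v_gt0] := posnP v; last first.
  left; have : (0 < wtq q n v)%N by apply: wtq_gt0; lia.
  by rewrite wtqE; case: (odd j) vE vO => /=; lia.
have lt_jk : (j < k)%N by rewrite -(ltn_exp2l _ _ q_gt1); lia.
have oj : odd j.
  apply/negPn/negP => ej; have lt_jd : (j./2 < d)%N by lia.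
  case/eqP: (tNQ _ lt_jd); rewrite -expnM mul2n (_ : j./2.*2 = j); lia.
have [vE0 vO0] := EO0 q n; rewrite v0 vE0 vO0 oj /= in vE vO.
by right; lia.
Qed.

End Digits.

(** * Locator polynomials and power sums *)

Section PowerSums.
Variable F : finFieldType.
Implicit Types (S : {set F}) (x : F -> F) (f P : {poly F}).

Definition locator S : {poly F} := \prod_(g in S) ('X - g%:P).

Lemma locator_seq S : locator S = \prod_(g <- enum S) ('X - g%:P).
Proof. by rewrite /locator big_enum. Qed.

Lemma size_locator S : size (locator S) = #|S|.+1.
Proof. by rewrite locator_seq size_prod_XsubC cardE. Qed.

Lemma monic_locator S : locator S \is monic.
Proof. by rewrite locator_seq monic_prod_XsubC. Qed.

Lemma root_locator S g : root (locator S) g = (g \in S).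
Proof. by rewrite locator_seq root_prod_XsubC mem_enum. Qed.

Lemma poly_eq0_on S P : (size P <= #|S|)%N -> {in S, forall g, root P g} -> P = 0.
Proof.
move=> sP rP; apply: (@roots_geq_poly_eq0 _ P (enum S)).
- by apply/allP=> g; rewrite mem_enum; apply: rP.
- exact: enum_uniq.
- by rewrite -cardE.
Qed.

Lemma locator_eq S f :
  f \is monic -> size f = #|S|.+1 -> {in S, forall g, root f g} -> f = locator S.
Proof.
move=> mf sf rf; rewrite [LHS](@all_roots_prod_XsubC _ _ (enum S)).
- by rewrite (monicP mf) scale1r locator_seq.
- by rewrite sf cardE.
- by apply/allP=> g; rewrite mem_enum; apply: rf.
- by rewrite uniq_rootsE enum_uniq.
Qed.

Lemma moment_poly S x T P : (forall u, (u < T)%N -> \sum_(g in S) x g * g ^+ u = 0) ->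
  (size P <= T)%N -> \sum_(g in S) x g * P.[g] = 0.
Proof.
move=> x0 sP; under eq_bigr do rewrite (horner_coef_wide _ sP) mulr_sumr.
rewrite exchange_big big1 //= => i _; under eq_bigr do rewrite mulrCA.
by rewrite -mulr_sumr x0 ?mulr0.
Qed.

Lemma locatorD1 S a : a \in S -> locator S = ('X - a%:P) * locator (S :\ a).
Proof. by move=> aS; rewrite /locator (big_setD1 a). Qed.

Lemma deriv_locator S a : a \in S -> (locator S)^`().[a] = (locator (S :\ a)).[a].
Proof.
by move=> aS; rewrite (@locatorD1 S a aS) derivM derivXsubC mul1r !hornerE subrr mul0r addr0.
Qed.

(** Testing against the locator of [S :\ a], which vanishes on [S] except at [a], isolates [x a]. *)
Lemma vandermonde S x : (forall u, (u < #|S|)%N -> \sum_(g in S) x g * g ^+ u = 0) ->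
  {in S, forall a, x a = 0}.
Proof.
move=> x0 a aS; have sz_a : (size (locator (S :\ a)) <= #|S|)%N.
  by rewrite size_locator [X in (_ <= X)%N](cardsD1 a) aS.
have /eqP := @moment_poly S x _ _ x0 sz_a.
rewrite (big_setD1 a) //= big1 ?addr0 => [|g]; last first.
  by rewrite -root_locator => /rootP->; rewrite mulr0.
rewrite mulf_eq0 => /orP[/eqP//|]; rewrite -[_ == 0]/(root _ a) root_locator.
by rewrite !inE eqxx.
Qed.

(* Lagrange interpolation of ['X^u] on [S], compared in degree [#|S| - 1]. *)
Lemma power_sum_locator S c u : (locator S)^`() = c%:P -> (u.+1 < #|S|)%N ->
  \sum_(g in S) g ^+ u = 0.
Proof.
move=> dS ltuS; pose L := \sum_(g in S) g ^+ u *: locator (S :\ g).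
have szD1 g : g \in S -> size (locator (S :\ g)) = #|S|.
  by move=> gS; rewrite size_locator [RHS](cardsD1 g) gS.
(* At [a] in [S] only the summand [g = a] of [L] survives; its value is [a ^+ u] times the
   derivative of the locator at [a], that is [c * a ^+ u]. *)
have/eqP: L - c *: 'X^u = 0.
  apply: (@poly_eq0_on S) => [|a aS].
    apply: (leq_trans (size_polyD _ _)); rewrite geq_max size_polyN.
    apply/andP; split.
      apply: (leq_trans (size_sum _ _ _)); apply/bigmax_leqP => g gS.
      by apply: (leq_trans (size_scale_leq _ _)); rewrite szD1.
    by apply: (leq_trans (size_scale_leq _ _)); rewrite size_polyXn ltnW.
  rewrite /root !hornerE horner_sum (big_setD1 a) //= big1 ?addr0 => [|g].
    by rewrite !hornerE -deriv_locator // dS hornerC mulrC subrr.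
  rewrite !inE => /andP[ga gS]; rewrite hornerZ.
  have /rootP-> : root (locator (S :\ g)) a by rewrite root_locator !inE eq_sym ga.
  by rewrite mulr0.
(* In degree [#|S|.-1] each monic [locator (S :\ g)], scaled by [g ^+ u], contributes [g ^+ u], and
   ['X^u] contributes nothing. *)
rewrite subr_eq0 => /eqP/(congr1 (fun P : {poly F} => P`_(#|S|.-1))).
rewrite coef_sumMXn || rewrite coef_sum.
rewrite coefZ coefXn gtn_eqF ?mulr0; last by lia.
move=> {2}<-; apply: eq_bigr => g gS; rewrite coefZ.
have /monicP := monic_locator (S :\ g); rewrite /lead_coef szD1 // => ->.
by rewrite mulr1.
Qed.

(* Comparing the moments [s_u] of [x] with the recursion they satisfy because
   the locator vanishes on [S]; two exceptional gaps cannot add up below [#|S|]. *)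
Lemma coef_locator_gap S x (T : pred nat) :
    (forall u, (u.+1 < #|S|)%N -> \sum_(g in S) x g * g ^+ u = 0) ->
    \sum_(g in S) x g * g ^+ #|S|.-1 != 0 ->
    (forall t, T t -> (#|S| <= t + t)%N) ->
    (forall t, (0 < t < #|S|)%N -> ~~ T t ->
       \sum_(g in S) x g * g ^+ (#|S|.-1 + t) = 0) ->
  forall t, (0 < t < #|S|)%N -> ~~ T t -> (locator S)`_(#|S| - t) = 0.
Proof.
move=> s0 s1 T2 sT t; elim/ltn_ind: t => t IHt t_bd Tt.
set D := #|S| in s0 s1 T2 sT IHt t_bd *.
(* In terms of moments: the sum over [i] of f_i s_(t - 1 + i) is 0. The index [i = D - t] carries
   the nonzero s_(D - 1); all other terms will vanish. *)
have: \sum_(g in S) x g * (g ^+ t.-1 * (locator S).[g]) = 0.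
  by apply: big1 => g; rewrite -root_locator => /rootP->; rewrite !mulr0.
have moveE i g : x g * (g ^+ t.-1 * ((locator S)`_i * g ^+ i)) =
    (locator S)`_i * (x g * g ^+ (t.-1 + i)).
  by rewrite exprD [RHS]mulrCA; congr (_ * _); apply: mulrCA.
under eq_bigr do rewrite horner_coef !mulr_sumr.
rewrite exchange_big size_locator /= -/D.
have lt_tD : (D - t < D.+1)%N by lia.
rewrite (bigD1 (Ordinal lt_tD)) //= [X in _ + X]big1 ?addr0 => [|i ne_it].
  under eq_bigr do rewrite moveE.
  rewrite -mulr_sumr (_ : (t.-1 + _)%N = D.-1); last by lia.
  by move/eqP; rewrite mulf_eq0 (negPf s1) orbF => /eqP.
under eq_bigr do rewrite moveE.
rewrite -mulr_sumr; have ne_i : (i != D - t :> nat)%N by [].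
have := ltn_ord i; rewrite ltnS leq_eqVlt => /predU1P[->|lt_iD].
  by rewrite (_ : (t.-1 + D)%N = (D.-1 + t)%N) ?sT ?mulr0 //; lia.
have [lt_i|ge_i] := ltnP i (D - t); first by rewrite s0 ?mulr0 //; lia.
(* Now [D - t < i < D]. Either the coefficient vanishes by induction, or [D - i] is exceptional and
   then [t - (D - i)] is not, since both together would force [t >= D]. *)
have [Ti|Ti] := boolP (T (D - i)%N); last first.
  have := IHt (D - i)%N; rewrite subKn ?(ltnW lt_iD) // => -> //; try lia.
  by rewrite mul0r.
have [Tti|Tti] := boolP (T (t - (D - i))%N).
  by have := T2 _ Ti; have := T2 _ Tti; lia.
by rewrite (_ : (t.-1 + i)%N = (D.-1 + (t - (D - i)))%N) ?sT ?mulr0 //; lia.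
Qed.

End PowerSums.

(** * Affine polynomials and subspaces *)

Section AffinePolynomials.
Variables (F : finFieldType) (Q : nat).
Hypothesis Q_pchar : [pchar F].-nat Q.
Implicit Types (f : {poly F}) (V : {set F}).

(** A [Q]-linearized polynomial plus a constant: for [Q] a power of the characteristic, subtracting
    the constant leaves a map linear over [Fsub Q]. *)
Definition affine_poly f : Prop :=
  forall i, (0 < i)%N -> f`_i != 0 -> exists j, i = (Q ^ j)%N.

Lemma horner_split0 f x :
  f.[x] = f`_0 + \sum_(i < size f) f`_i.+1 * x ^+ i.+1.
Proof. by rewrite (horner_coef_wide _ (leqnSn _)) big_ord_recl expr0 mulr1. Qed.

Lemma Q_exp_pchar j : [pchar F].-nat (Q ^ j)%N.
Proof. by rewrite pnatX Q_pchar. Qed.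

Lemma affine_polyD f x y : affine_poly f -> f.[x + y] = f.[x] + f.[y] - f`_0.
Proof.
move=> fQ; rewrite !horner_split0 addrACA -[_ + _ + (_ + _)]addrA [RHS]addrC addKr.
rewrite -big_split; congr (_ + _); apply: eq_bigr => i _ /=; rewrite -mulrDr.
have [->|f_neq0] := eqVneq f`_i.+1 0; first by rewrite !mul0r.
by have [//|j ->] := fQ i.+1 _ f_neq0; rewrite exprDn_pchar ?Q_exp_pchar.
Qed.

Lemma Fsub_exp (c : F) j : c \in Fsub Q -> c ^+ (Q ^ j) = c.
Proof.
by move=> /eqP cQ; elim: j => [|j IHj]; rewrite ?expn0 ?expr1 // expnSr exprM IHj.
Qed.

Lemma affine_polyZ f c x : affine_poly f -> c \in Fsub Q ->
  f.[c * x] - f`_0 = c * (f.[x] - f`_0).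
Proof.
move=> fQ cQ; rewrite !horner_split0 ![f`_0 + _]addrC !addrK mulr_sumr.
apply: eq_bigr => i _; have [->|f_neq0] := eqVneq f`_i.+1 0; first by rewrite !mul0r mulr0.
by have [//|j ->] := fQ i.+1 _ f_neq0; rewrite exprMn (@Fsub_exp _ _ cQ) mulrCA.
Qed.

(** In degree [Q ^ j] with [j > 0] the derivative picks up a factor divisible by [Q], which is 0 in
    [F]. *)
Lemma deriv_affine_poly f : Q%:R = 0 :> F -> affine_poly f -> f^`() = (f`_1)%:P.
Proof.
move=> Q0 fQ; apply/polyP=> i; rewrite coef_deriv coefC.
case: i => [|i] //=; have [->|f_neq0] := eqVneq f`_i.+2 0; first by rewrite mul0rn.
have [//|[|j] def_i] := fQ i.+2 _ f_neq0; first by rewrite expn0 in def_i.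
by rewrite def_i -mulr_natr natrX Q0 expr0n mulr0.
Qed.


Lemma exp_sum_pchar (R : comNzRingType) (I : Type) (r : seq I) (P : pred I) (E : I -> R) n :
  [pchar R].-nat n -> (\sum_(i <- r | P i) E i) ^+ n = \sum_(i <- r | P i) E i ^+ n.
Proof.
move=> n_pchar; apply: (big_morph (fun z => z ^+ n)) => [y z|].
  exact: exprDn_pchar.
by rewrite expr0n gtn_eqF //; case/andP: n_pchar.
Qed.

(** Raising to the power [Q] is additive, so it multiplies every exponent of [f] by [Q]. *)
Lemma affine_polyX f : affine_poly f -> affine_poly (f ^+ Q).
Proof.
move=> fQ n n_gt0; rewrite -{1}[f]coefK poly_def exp_sum_pchar; last first.
  by rewrite (eq_pnat _ (pchar_poly F)).
rewrite coef_sum => f_neq0.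
have [i] : exists i : 'I_(size f), ((f`_i *: 'X^i) ^+ Q)`_n != 0.
  apply/existsP; apply: contraNT f_neq0; rewrite negb_exists => /forallP f0.
  by rewrite big1 // => i _; apply/eqP/negPn.
rewrite exprZn -exprM coefZ coefXn; case: (n =P _) => [def_n|_]; last by rewrite mulr0 eqxx.
have Q_gt0 : (0 < Q)%N by case/andP: Q_pchar.
rewrite mulr1 expf_eq0 Q_gt0 /= => fi_neq0.
have [|j def_i] := fQ i _ fi_neq0; first by move: n_gt0; rewrite def_n muln_gt0 => /andP[].
by exists j.+1; rewrite expnSr -def_i.
Qed.

Lemma affine_polyB f g : affine_poly f -> affine_poly g -> affine_poly (f - g).
Proof.
move=> fQ gQ i i_gt0; rewrite coefB.
have [-> | fi _] := eqVneq f`_i 0; last exact: fQ.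
by rewrite sub0r oppr_eq0; apply: gQ.
Qed.

Lemma affine_poly_scale f c : affine_poly f -> affine_poly (c *: f).
Proof. by move=> fQ i i_gt0; rewrite coefZ mulf_eq0 => /norP[_]; apply: fQ. Qed.

End AffinePolynomials.

(** * Subspaces over the fixed field of the [Q]-Frobenius *)

Section Subspaces.
Variables (F : finFieldType) (Q : nat).
Hypothesis Q_pchar : [pchar F].-nat Q.
Implicit Type V : {set F}.
Let K := @Fsub F Q.

Let Q_gt0 : (0 < Q)%N. Proof. by case/andP: Q_pchar. Qed.

Lemma Fsub0 : 0 \in K.
Proof. by rewrite inE expr0n gtn_eqF. Qed.

Lemma FsubB a b : a \in K -> b \in K -> a - b \in K.
Proof.
by move=> /eqP Ka /eqP Kb; rewrite inE exprDn_pchar // exprNn_pchar // Ka Kb.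
Qed.

Lemma Fsub_div a b : a \in K -> b \in K -> a / b \in K.
Proof. by move=> /eqP Ka /eqP Kb; rewrite inE exprMn exprVn Ka Kb. Qed.

Definition subspace V : Prop :=
  [/\ 0 \in V, {in V &, forall v w, v + w \in V} & {in K & V, forall c v, c * v \in V}].

Definition Kspan d (b : 'I_d -> F) : {set F} :=
  [set \sum_(i < d) c i * b i | c : {ffun 'I_d -> F} in ffun_on K].

Definition Kfree d (b : 'I_d -> F) : Prop :=
  forall c : 'I_d -> F, (forall i, c i \in K) -> \sum_(i < d) c i * b i = 0 -> forall i, c i = 0.

Lemma KspanP d (b : 'I_d -> F) v :
  v \in Kspan b <-> exists c : 'I_d -> F, (forall i, c i \in K) /\ v = \sum_(i < d) c i * b i.
Proof.
split=> [/imsetP[c /ffun_onP Kc ->]|[c [Kc ->]]]; first by exists c.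
apply/imsetP; exists [ffun i => c i]; first by apply/ffun_onP => i; rewrite ffunE.
by apply: eq_bigr => i _; rewrite ffunE.
Qed.

Lemma subspace_of_dimP d V :
  subspace_of_dim K d V <-> exists2 b : 'I_d -> F, Kfree b & V = Kspan b.
Proof.
split=> [[b [b_free bV]]|[b b_free ->]].
  exists b => [c Kc c0 i|].
    apply: (b_free c (fun=> 0)) => //; first by move=> _; exact: Fsub0.
    by rewrite c0 big1 // => j _; rewrite mul0r.
  by apply/setP=> v; apply/idP/idP=> [/bV/KspanP|/KspanP/bV].
exists b; split=> [c c' Kc Kc' eq_cc' i|v]; last exact: KspanP.
apply/eqP; rewrite -subr_eq0; apply/eqP.
apply: (b_free (fun i => c i - c' i)) => [j|]; first exact: FsubB.
by under eq_bigr do rewrite mulrBl; rewrite sumrB eq_cc' subrr.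
Qed.

Lemma card_Kspan d (b : 'I_d -> F) : Kfree b -> #|Kspan b| = (#|K| ^ d)%N.
Proof.
move=> b_free; rewrite card_in_imset ?card_ffun_on ?card_ord //.
move=> c c' /ffun_onP Kc /ffun_onP Kc' eq_cc'; apply/ffunP=> i.
apply/eqP; rewrite -subr_eq0; apply/eqP.
apply: (b_free (fun i => c i - c' i)) => [j|]; first exact: FsubB.
by under eq_bigr do rewrite mulrBl; rewrite sumrB eq_cc' subrr.
Qed.

(** Greedy choice: by counting, the span of the free vectors found so far cannot contain [V], so a
    vector of [V] outside it extends the family. *)
Lemma exists_Kfree d V : subspace V -> (1 < #|K|)%N -> (#|K| ^ d <= #|V|)%N ->
  exists2 b : 'I_d -> F, Kfree b & {subset Kspan b <= V}.
Proof.
move=> [V0 VD VZ] K_gt1; elim: d => [|d IHd] le_V.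
  exists (fun=> 0) => [c _ _ []//|v /KspanP[c [_ ->]]]; by rewrite big_ord0.
have [|b b_free bV] := IHd; first by rewrite (leq_trans _ le_V) // leq_exp2l.
have [v Vv b'v] : exists2 v, v \in V & v \notin Kspan b.
  apply/subsetPn/negP => /subset_leq_card; rewrite card_Kspan // => le_b.
  by have := leq_trans le_V le_b; rewrite leq_exp2l // ltnn.
pose b1 i := if unlift ord0 i is Some j then b j else v.
have sum_b1 (c : 'I_d.+1 -> F) :
    \sum_i c i * b1 i = c ord0 * v + \sum_(i < d) c (lift ord0 i) * b i.
  rewrite big_ord_recl {1}/b1 unlift_none; congr (_ + _).
  by apply: eq_bigr => i _; rewrite /b1 liftK.
exists b1 => [c Kc|w /KspanP[c [Kc ->]]]; rewrite sum_b1; last first.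
  by apply: VD; [apply: VZ | apply/bV/KspanP; exists (fun i => c (lift ord0 i))].
have [c0 | c0 sum0] := eqVneq (c ord0) 0.
  rewrite c0 mul0r add0r => c_eq0 i; case: (unliftP ord0 i) => [j|] ->; last by [].
  by apply: (b_free (fun j => c (lift ord0 j))) => // k; apply: Kc.
case/negP: b'v; apply/KspanP.
exists (fun i => (0 - c (lift ord0 i)) / c ord0); split=> [i|].
  by apply: Fsub_div => //; apply: FsubB => //; apply: Fsub0.
apply: (mulfI c0); rewrite mulr_sumr; move/eqP: sum0; rewrite addr_eq0 => /eqP->.
rewrite -sumrN; apply: eq_bigr => i _.
by rewrite sub0r mulrA [X in _ = X * _]mulrC divfK // mulNr.
Qed.

Lemma subspace_of_dim_card d V : subspace V -> (1 < #|K|)%N -> #|V| = (#|K| ^ d)%N ->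
  subspace_of_dim K d V.
Proof.
move=> subV K_gt1 cV; have [|b b_free bV] := @exists_Kfree d V subV K_gt1.
  by rewrite cV.
apply/subspace_of_dimP; exists b => //; apply/esym/eqP.
rewrite eqEcard card_Kspan // cV leqnn andbT; exact/subsetP.
Qed.

Lemma exists_subspace d : (1 < #|K|)%N -> (#|K| ^ d <= #|F|)%N ->
  exists V, subspace_of_dim K d V.
Proof.
move=> K_gt1 le_dF; have [||b b_free _] := @exists_Kfree d setT _ K_gt1.
- by split=> [|v w _ _|c v _ _]; rewrite in_setT.
- by rewrite cardsT.
by exists (Kspan b); apply/subspace_of_dimP; exists b.
Qed.

(* [f_(V + K b) = f_V ^ Q - f_V(b) ^ (Q - 1) f_V] *)
Lemma Kspan_poly d (b : 'I_d -> F) : (1 < Q)%N ->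
  exists f, [/\ f \is monic, size f = (Q ^ d).+1, affine_poly Q f
               & {in Kspan b, forall v, root f v}].
Proof.
move=> Q_gt1; elim: d b => [|d IHd] b.
  exists 'X; rewrite monicX size_polyX; split=> // [i i_gt0|v /KspanP[c [_ ->]]].
    by rewrite coefX; case: (i =P 1%N) => [-> _|_]; [exists 0%N | rewrite eqxx].
  by rewrite big_ord0 /root hornerX.
have [f [f_monic sf fQ rf]] := IHd (fun i => b (lift ord0 i)).
have f0 : f`_0 = 0.
  rewrite -horner_coef0; apply/eqP/rf/KspanP; exists (fun=> 0); split=> [_|].
    exact: Fsub0.
  by rewrite big1 // => i _; rewrite mul0r.
have szfQ : size (f ^+ Q) = (Q ^ d.+1).+1.
  by rewrite polySpred ?monic_neq0 ?monic_exp // size_exp sf expnSr.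
have lt_sz : (size (- (f.[b ord0] ^+ Q.-1 *: f)) < size (f ^+ Q))%N.
  rewrite size_polyN (leq_ltn_trans (size_scale_leq _ _)) // sf szfQ ltnS.
  by rewrite ltn_exp2l.
exists (f ^+ Q - f.[b ord0] ^+ Q.-1 *: f); split.
- by rewrite monicE lead_coefDl // -monicE monic_exp.
- by rewrite size_polyDl.
- by apply: affine_polyB; [apply: affine_polyX | apply: affine_poly_scale].
move=> v /KspanP[c [Kc ->]]; rewrite big_ord_recl.
(* [f] is linear over the fixed field and kills the span of the other basis vectors; with
   [c ord0 ^+ Q = c ord0] the two terms of the new polynomial cancel. *)
have fv : f.[c ord0 * b ord0 + \sum_(i < d) c (lift ord0 i) * b (lift ord0 i)]
    = c ord0 * f.[b ord0].
  rewrite (affine_polyD Q_pchar) // f0 subr0 [X in _ + X](_ : _ = 0); last first.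
    by apply/eqP/rf/KspanP; exists (fun i => c (lift ord0 i)).
  by have := affine_polyZ (b ord0) fQ (Kc ord0); rewrite f0 !subr0 addr0.
rewrite /root !hornerE fv exprMn.
have /eqP-> : c ord0 \in K by [].
by rewrite mulrCA -exprSr prednK // subrr.
Qed.

End Subspaces.

(** At most [Q] elements, as roots of ['X^Q - 'X]; at least [Q], namely 0 and the powers of a
    primitive root of unity of order [Q.-1], itself a power of [alpha]. *)
Lemma card_Fsub (F : finFieldType) (Q m : nat) (alpha : F) : (1 < Q)%N -> (0 < m)%N ->
  (Q ^ m).-1.-primitive_root alpha -> #|@Fsub F Q| = Q.
Proof.
move=> Q_gt1 m_gt0 alphaP; apply/eqP; rewrite eqn_leq; apply/andP; split.
  have nz : 'X^Q - 'X != 0 :> {poly F}.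
    rewrite -size_poly_gt0 size_polyDl size_polyXn // size_polyN size_polyX //.
  have := max_poly_roots nz _ (enum_uniq (@Fsub F Q)).
  rewrite -cardE size_polyDl size_polyXn ?size_polyN ?size_polyX // ltnS; apply.
  by apply/allP=> a; rewrite mem_enum /root !hornerE subr_eq0.
have betaP := dvdn_prim_root alphaP (dvdn_pred_predX Q m).
set beta := alpha ^+ _ in betaP.
pose B : {set F} := 0 |: [set beta ^+ val i | i : 'I_Q.-1].
have cardB : #|B| = Q.
  rewrite cardsU1 card_imset => [|i j /eqP]; last first.
    by rewrite (eq_prim_root_expr betaP) !modn_small ?ltn_ord // => /eqP/val_inj.
  rewrite card_ord; case: imsetP => [[i _ /eqP]|_]; last by rewrite add1n prednK // ltnW.
  by rewrite eq_sym expf_eq0 (prim_root_eq0 betaP) => /andP[_]; lia.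
rewrite -[X in (X <= _)%N]cardB.
apply/subset_leq_card/subsetP => a; rewrite 2!inE => /predU1P[->|/imsetP[i _ ->]]; rewrite inE.
  by rewrite expr0n gtn_eqF // ltnW.
have betaQ : beta ^+ Q = beta.
  by rewrite -{1}(prednK (ltnW Q_gt1)) exprSr (prim_expr_order betaP) mul1r.
by rewrite -exprM mulnC exprM betaQ.
Qed.

(** * Cosets of subspaces and their affine locators *)

Section AffineSubspaces.
Variables (F : finFieldType) (q : nat).
Hypotheses (q_gt1 : (1 < q)%N) (q_pchar : [pchar F].-nat q) (q0 : q%:R = 0 :> F).
Implicit Types (S V : {set F}).

Let Q_pchar : [pchar F].-nat (q ^ 2)%N. Proof. by rewrite pnatX q_pchar. Qed.
Let Q0 : (q ^ 2)%:R = 0 :> F. Proof. by rewrite natrX q0 expr0n. Qed.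

(* The top digit of [u] is traded, through a Frobenius power of the relation
   [f(g) = 0], for lower digits in positions of the same parity. *)
Lemma affine_power_sum n d S : (2 * d <= n)%N -> #|S| = (q ^ (2 * d))%N ->
    affine_poly (q ^ 2) (locator S) ->
  forall u, (u < q ^ n)%N ->
    (wtq q n u < 2 * d * (q - 1))%N \/
    wtq q n u = (2 * d * (q - 1))%N /\ Eq q n u != Oq q n u ->
  \sum_(g in S) g ^+ u = 0.
Proof.
move=> le_dn cardS fQ u; elim/ltn_ind: u => u IHu lt_u wt_u.
have [k Dk] : {k | k = (2 * d)%N} by exists (2 * d)%N.
rewrite -Dk in le_dn cardS IHu wt_u.
have [lt_uk|ge_uk] := ltnP u.+1 (q ^ k).
  by apply: (power_sum_locator (deriv_affine_poly Q0 fQ)); rewrite cardS.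
(* The only exponent left below [q ^ k] is [q ^ k - 1]. It has weight [k * (q - 1)] and, [k] being
   even, equal even and odd digit sums, so the hypothesis on [u] excludes it. *)
have [lt_uk|{}ge_uk] := ltnP u (q ^ k).
  have [|defE defO] := @EO_compl q q_gt1 n k u 0 le_dn; first by lia.
  have [E0 O0] := EO0 q n; rewrite wtqE in wt_u.
  have kE : (k * (q - 1) = d * (q - 1) + d * (q - 1))%N by rewrite Dk mul2n -addnn mulnDl.
  have [hkE hkO] : uphalf k = d /\ k./2 = d by lia.
  by rewrite hkE hkO in defE defO; lia.
have [|j [u' [j_bd def_u uE uO]]] := @EO_split q q_gt1 n k u; first by rewrite ge_uk.
(* The [e]-th power of the relation has leading term [g ^+ (q ^ j)], so multiplying by [g ^+ u']
   puts [g ^+ u] on top. *)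
pose e := (q ^ (j - k))%N; have e_gt0 : (0 < e)%N by rewrite expn_gt0 ltnW.
have e_pchar : [pchar F].-nat e by rewrite pnatX q_pchar.
have: \sum_(g in S) g ^+ u' * (locator S).[g] ^+ e = 0.
  by apply: big1 => g; rewrite -root_locator => /rootP->; rewrite expr0n gtn_eqF // mulr0.
have moveE g : g ^+ u' * (locator S).[g] ^+ e =
    \sum_(i < (q ^ k).+1) (locator S)`_i ^+ e * g ^+ (u' + i * e).
  rewrite horner_coef size_locator cardS exp_sum_pchar // mulr_sumr.
  by apply: eq_bigr => i _; rewrite exprMn -exprM exprD mulrCA.
under eq_bigr do rewrite moveE.
rewrite exchange_big big_ord_recr /= [X in X + _]big1 ?add0r => [|i _].
  have /monicP := monic_locator S; rewrite /lead_coef size_locator cardS /= => ->.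
  under eq_bigr do rewrite expr1n mul1r.
  by rewrite /e -expnD subnKC -?def_u //; lia.
rewrite -mulr_sumr; have [->|f_neq0] := eqVneq (locator S)`_i 0.
  by rewrite expr0n gtn_eqF // mul0r.
have u'P w : (w < u)%N ->
    (wtq q n w < wtq q n u)%N \/ Eq q n w = Eq q n u /\ Oq q n w = Oq q n u ->
  \sum_(g in S) g ^+ w = 0.
  move=> lt_wu w_wt; apply: IHu => //; first exact: ltn_trans lt_u.
  by move: w_wt wt_u; rewrite !wtqE; lia.
have wt_u' : (wtq q n u' < wtq q n u)%N by rewrite !wtqE uE uO; case: (odd j); lia.
have lt_u'u : (u' < u)%N by rewrite def_u -addn1 leq_add2l expn_gt0 ltnW.
have [i0|i_gt0] := posnP i; first by rewrite i0 mul0n addn0 u'P ?mulr0 //; left.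
have [j' def_i] := fQ i i_gt0 f_neq0.
have lt_jk : (2 * j' < k)%N by rewrite -(ltn_exp2l _ _ q_gt1) expnM -def_i ltn_ord.
have -> : (i * e = q ^ (2 * j' + (j - k)))%N by rewrite def_i -expnM -expnD.
rewrite u'P ?mulr0 //; first by rewrite def_u ltn_add2l ltn_exp2l //; lia.
(* As [k] is even, the new digit has the parity of [j]: without carry both digit sums are those of
   [u]; otherwise the weight is at most that of [u'], below that of [u]. *)
have odd_j : odd (2 * j' + (j - k)) = odd j by lia.
case: (EO_addX q_gt1 n (2 * j' + (j - k)) u') => [|le_u']; last by left; lia.
by rewrite odd_j -uE -uO; right.
Qed.

(** If [f] is the monic affine polynomial vanishing on [V], subtracting the constant [f.[h]] makes
    it vanish on the coset; its degree is right once the fixed field has [q ^ 2] elements. *)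
Lemma locator_coset d V h : subspace_of_dim (Fsub (q ^ 2)) d V ->
  [/\ #|[set g | g - h \in V]| = (#|@Fsub F (q ^ 2)| ^ d)%N
    & #|@Fsub F (q ^ 2)| = (q ^ 2)%N ->
      affine_poly (q ^ 2) (locator [set g | g - h \in V])].
Proof.
move=> /(subspace_of_dimP Q_pchar)[b b_free ->].
have cardS : #|[set g | g - h \in Kspan (q ^ 2) b]| = (#|@Fsub F (q ^ 2)| ^ d)%N.
  rewrite -(card_Kspan Q_pchar b_free) -[RHS](card_imset _ (addIr h)).
  apply: eq_card => g; rewrite inE; apply/idP/imsetP => [Vg|[v Vv ->]].
    by exists (g - h); rewrite // subrK.
  by rewrite addrK.
split=> // cardK; have [|f [f_monic sf fQ rf]] := Kspan_poly Q_pchar b.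
  by rewrite -[1%N](exp1n 2) ltn_exp2r.
have f0 : f`_0 = 0.
  rewrite -horner_coef0; apply/eqP/rf/KspanP; exists (fun=> 0); split=> [_|].
    exact: Fsub0.
  by rewrite big1 // => i _; rewrite mul0r.
have sc : (size (- f.[h]%:P) < size f)%N.
  rewrite size_polyN sf ltnS (leq_trans (size_polyC_leq1 _)) //.
  by rewrite expn_gt0 expn_gt0 ltnW.
rewrite -(@locator_eq _ _ (f - f.[h]%:P)).
- apply: affine_polyB => // i i_gt0; rewrite coefC; case: i i_gt0 => //= i _.
  by rewrite eqxx.
- by rewrite monicE lead_coefDl // -monicE.
- by rewrite size_polyDl // sf cardS cardK.
move=> g; rewrite inE => /rf/rootP fgh; rewrite /root !hornerE -{1}(subrK h g).
by rewrite (affine_polyD Q_pchar) // fgh f0 subr0 add0r subrr.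
Qed.

(** As [f] vanishes at [h], translating [S] by [- h] gives the set where [f] equals its constant
    coefficient: the kernel of a linear map, whose dimension follows by counting. *)
Lemma affine_locator_coset d S h : (1 < #|@Fsub F (q ^ 2)|)%N ->
    #|S| = (#|@Fsub F (q ^ 2)| ^ d)%N ->
    affine_poly (q ^ 2) (locator S) -> h \in S ->
  exists2 V, subspace_of_dim (Fsub (q ^ 2)) d V & S = [set g | g - h \in V].
Proof.
set f := locator S => K_gt1 cardS fQ hS.
pose V := [set v | v + h \in S].
have memV v : (v \in V) = (v + h \in S) by rewrite inE.
have fV v : (v \in V) = (f.[v] == f`_0).
  rewrite memV -root_locator /root -/f (affine_polyD Q_pchar) //.
  move: hS; rewrite -root_locator => /rootP; rewrite -/f => ->.
  by rewrite addr0 subr_eq0.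
have cardV : #|V| = #|S|.
  rewrite -[LHS](card_imset _ (addIr h)); apply: eq_card => g.
  apply/imsetP/idP => [[v Vv ->]|Sg]; first by rewrite -memV.
  by exists (g - h); rewrite ?subrK // memV subrK.
exists V; last by apply/setP=> g; rewrite inE memV subrK.
apply: subspace_of_dim_card => //; last by rewrite cardV.
split=> [|v w|c v Kc]; rewrite !fV.
- by rewrite horner_coef0.
- by move=> /eqP v0 /eqP w0; rewrite (affine_polyD Q_pchar) // v0 w0 addrK.
by move=> /eqP v0; rewrite -subr_eq0 (affine_polyZ _ fQ Kc) v0 subrr mulr0.
Qed.

End AffineSubspaces.

(** * The code *)

Section Code.
Variables (F : finFieldType) (q m : nat) (alpha : F) (rho' : nat) (I : pred nat).
Hypotheses (q_gt1 : (1 < q)%N) (q_pchar : [pchar F].-nat q) (q0 : q%:R = 0 :> F).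
Hypotheses (cardF : #|F| = (q ^ (2 * m))%N) (alphaP : (q ^ (2 * m)).-1.-primitive_root alpha).
Hypotheses (lt_rho : (rho' < m)%N).

Let d := (m - rho')%N.
Let r := (2 * rho' * (q - 1))%N.
Let code := in_C q m alpha r I.
Implicit Types (x : F -> F) (V : {set F}).

Let Q_gt1 : (1 < q ^ 2)%N. Proof. by rewrite -[1%N](exp1n 2) ltn_exp2r. Qed.
Let Q0 : (q ^ 2)%:R = 0 :> F. Proof. by rewrite natrX q0 expr0n. Qed.
Let d_gt0 : (0 < d)%N. Proof. by rewrite subn_gt0. Qed.
Let le_dm : (2 * d <= 2 * m)%N. Proof. by rewrite leq_mul2l leq_subr. Qed.

Let top_weight : (2 * m * (q - 1) - r = 2 * d * (q - 1))%N.
Proof. by rewrite -mulnBl -mulnBr. Qed.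

Let top_weight_gt0 : (0 < 2 * d * (q - 1))%N.
Proof. by rewrite !muln_gt0 d_gt0 subn_gt0. Qed.

Let cardK : #|@Fsub F (q ^ 2)| = (q ^ 2)%N.
Proof.
by apply: (@card_Fsub F _ m alpha) => //; [exact: leq_ltn_trans lt_rho | rewrite -expnM].
Qed.

Lemma hwt_coset x (lam h : F) V : subspace_of_dim (Fsub (q ^ 2)) d V ->
    lam != 0 -> (forall g, x g = if g - h \in V then lam else 0) -> hwt x = (q ^ (2 * d))%N.
Proof.
move=> dimV lam_neq0 xE; have [cardS _] := locator_coset q_gt1 q_pchar h dimV.
rewrite cardK -expnM in cardS; rewrite -cardS; apply: eq_card => g.
by rewrite !inE xE; case: ifP => _ //; rewrite eqxx.
Qed.

(** * Scaled indicators of cosets as codewords *)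

Hypothesis I0 : I 0%N.

(** [alpha ^+ u] fixes [u] only modulo the group order, so [u] is replaced by the exponent
    witnessing membership. Since 0 is in [I], a [Theta] in the defining set has nonzero index,
    whence the even and odd sums differ. *)
Lemma exponent_of_Zr u : alpha ^+ u \in ZrI q m alpha r I ->
  exists u', [/\ (0 < u' < q ^ (2 * m))%N,
    (wtq q (2 * m) u' < 2 * d * (q - 1))%N \/
    wtq q (2 * m) u' = (2 * d * (q - 1))%N /\ Eq q (2 * m) u' != Oq q (2 * m) u'
    & forall g : F, g != 0 -> g ^+ u = g ^+ u'].
Proof.
have exp_eq u' (g : F) : alpha ^+ u == alpha ^+ u' -> g != 0 -> g ^+ u = g ^+ u'.
  rewrite (eq_prim_root_expr alphaP) => /eqP eq_uu' g_neq0.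
  have gN : g ^+ (q ^ (2 * m)).-1 = 1.
    apply: (mulIf g_neq0); rewrite mul1r -exprSr prednK ?expn_gt0 ?(ltnW q_gt1) //.
    by rewrite -cardF expf_card.
  by rewrite -(expr_mod u gN) eq_uu' expr_mod.
rewrite inE => /orP[/imsetP[u']|/bigcupP[k /andP[_ Ik] /imsetP[u']]].
  rewrite inE top_weight => /andP[u'_gt0 wt_u'] /eqP eq_uu'; exists (val u').
  split; [by rewrite u'_gt0 ltn_ord | left | by move=> g; apply: exp_eq].
  by apply: leq_ltn_trans wt_u' _; rewrite subn1 ltn_predL.
rewrite inE top_weight => /andP[/eqP wt_u' /eqP oe_u'] /eqP eq_uu'; exists (val u').
have [E0 O0] := EO0 q (2 * m).
split; last by move=> g; apply: exp_eq.
  rewrite ltn_ord andbT lt0n; apply: contra_eqN wt_u' => /eqP->.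
  by rewrite wtqE E0 O0 eq_sym -lt0n.
right; split=> //; apply: contraNN Ik => /eqP eqEO.
by rewrite -oe_u' /absOE eqEO subnn.
Qed.

Lemma coset_in_code x (lam h : F) V : subspace_of_dim (Fsub (q ^ 2)) d V ->
    lam \in Fsub q -> (forall g, x g = if g - h \in V then lam else 0) -> code x.
Proof.
move=> dimV Klam xE; have [cardS fQ] := locator_coset q_gt1 q_pchar h dimV.
have mom u : (u < q ^ (2 * m))%N -> (wtq q (2 * m) u < 2 * d * (q - 1))%N \/
    wtq q (2 * m) u = (2 * d * (q - 1))%N /\ Eq q (2 * m) u != Oq q (2 * m) u ->
    \sum_g x g * g ^+ u = 0.
  move=> lt_u wt_u; rewrite cardK -expnM in cardS.
  have := affine_power_sum q_gt1 q_pchar q0 le_dm cardS (fQ cardK) lt_u wt_u.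
  move/(congr1 ( *%R lam)); rewrite mulr0 mulr_sumr big_mkcond /= => sum0; rewrite -[RHS]sum0.
  by apply: eq_bigr => g _; rewrite xE inE; case: ifP => // _; rewrite mul0r.
split; [split=> [g _|u u_bd]|].
- by rewrite xE; case: ifP => // _; rewrite inE expr0n gtn_eqF // ltnW.
- case/exponent_of_Zr => u' [/andP[u'_gt0 lt_u'] wt_u' uu'].
  have := mom u' lt_u' wt_u'; rewrite (bigD1 0) //= expr0n gtn_eqF // mulr0 add0r => sum0.
  rewrite -[RHS]sum0.
  by apply: eq_bigr => g g_neq0; rewrite uu'.
(* The extension rule is the vanishing of the moment of exponent 0, with [0 ^+ 0 = 1]. *)
apply/eqP; rewrite -addr_eq0; apply/eqP.
rewrite -[RHS](mom 0%N).
- rewrite [RHS](bigD1 0) //= expr0 mulr1; congr (_ + _).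
  by apply: eq_bigr => g _; rewrite expr0 mulr1.
- by rewrite expn_gt0 ltnW.
by left; have [E0 O0] := EO0 q (2 * m); rewrite wtqE E0 O0.
Qed.

(** * Moments, weight and support of codewords *)

Hypothesis I2 : ~~ I 2.

(** The second case uses [Theta] of index 2, part of the defining set because 2 has the parity of
    [r], is at most [m * (q - 1)] and is not in [I]. *)
Lemma Zr_exponent u : (u < q ^ (2 * m))%N -> (0 < u)%N ->
    (wtq q (2 * m) u < 2 * d * (q - 1))%N \/
    [/\ wtq q (2 * m) u = (2 * d * (q - 1))%N, absOE q (2 * m) u = 2 & (2 <= m * (q - 1))%N] ->
  alpha ^+ u \in ZrI q m alpha r I.
Proof.
move=> lt_u u_gt0 wt_u; rewrite inE; apply/orP; case: wt_u => [wt_u|[wt_u oe_u m_ge2]].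
  left; apply/imsetP; exists (Ordinal lt_u) => //.
  by rewrite inE /= u_gt0 top_weight; lia.
right; apply/bigcupP; exists (Ordinal (m_ge2 : (2 < (m * (q - 1)).+1)%N)).
  by rewrite /= /Mr m_ge2 /r -mulnA oddM /= I2.
by apply/imsetP; exists (Ordinal lt_u); rewrite // inE /= wt_u oe_u top_weight !eqxx.
Qed.

Lemma code_moment x u : code x -> (u < q ^ (2 * m))%N ->
    (wtq q (2 * m) u < 2 * d * (q - 1))%N \/
    [/\ wtq q (2 * m) u = (2 * d * (q - 1))%N, absOE q (2 * m) u = 2 & (2 <= m * (q - 1))%N] ->
  \sum_(g in [set g | x g != 0]) x g * g ^+ u = 0.
Proof.
move=> [[_ x_mom] x0] lt_u wt_u; rewrite big_mkcond /=.
rewrite (eq_bigr (fun g => x g * g ^+ u)) => [|g _]; last first.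
  by rewrite inE; case: eqP => // ->; rewrite mul0r.
rewrite (bigD1 0) //= expr0n; have [->|u_gt0] := posnP u.
  by rewrite mulr1 x0; under eq_bigr do rewrite mulr1; rewrite addNr.
rewrite mulr0 add0r x_mom //; first by rewrite u_gt0; lia.
exact: Zr_exponent.
Qed.

Lemma code_low_moment x u : code x -> (u.+1 < q ^ (2 * d))%N ->
  \sum_(g in [set g | x g != 0]) x g * g ^+ u = 0.
Proof.
move=> Cx lt_u; have le_q : (q ^ (2 * d) <= q ^ (2 * m))%N by rewrite leq_exp2l.
by apply: code_moment => //; [lia | left; apply: wtq_lt => //; lia].
Qed.

Lemma code_weight_geq x : code x -> (exists g, x g != 0) -> (q ^ (2 * d) <= hwt x)%N.
Proof.
move=> Cx [a xa]; rewrite leqNgt; apply/negP => lt_x; case/negP: (xa); apply/eqP.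
apply: (@vandermonde _ [set g | x g != 0]); last by rewrite inE.
by move=> u lt_u; apply: code_low_moment => //; apply: leq_ltn_trans lt_x.
Qed.

Lemma min_weight_locator x : code x -> hwt x = (q ^ (2 * d))%N ->
  affine_poly (q ^ 2) (locator [set g | x g != 0]).
Proof.
set S := [set g | x g != 0] => Cx cardS; have {}cardS : #|S| = (q ^ (2 * d))%N by [].
(* For [d = m] the support is all of [F], with locator ['X^#|F| - 'X]; the window of exponents used
   below needs [d < m]. *)
have [eq_dm|ne_dm] := eqVneq d m.
  have -> : locator S = 'X^(q ^ (2 * d)) - 'X.
    have -> : S = setT by apply/eqP; rewrite eqEcard subsetT cardsT cardF cardS eq_dm /=.
    rewrite eq_dm -cardF finField_genPoly; apply: eq_bigl => g; exact: in_setT.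
  move=> i i_gt0; rewrite coefB coefXn coefX.
  have [-> _|_] := eqVneq i (q ^ (2 * d))%N; first by exists d; rewrite expnM.
  have [-> _|_] := eqVneq i 1%N; first by exists 0%N.
  by rewrite subrr eqxx.
have lt_dm : (d < m)%N by rewrite ltn_neqAle ne_dm leq_subr.
(* The gaps at which the weight argument gives no vanishing moment. Each is at least half of
   [q ^ (2 * d)], because [i < d]. *)
pose T t := [exists i : 'I_d, t == (q ^ (2 * d) - (q ^ 2) ^ i)%N].
have lt_Qi (i : 'I_d) : ((q ^ 2) ^ i + (q ^ 2) ^ i <= q ^ (2 * d))%N.
  rewrite addnn -mul2n expnM; apply: (@leq_trans ((q ^ 2) ^ i.+1)).
    by rewrite (expnS (q ^ 2)) leq_mul2r Q_gt1 orbT.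
  by rewrite leq_exp2l.
have le_q : (q ^ (2 * d).+1 <= q ^ (2 * m))%N by rewrite leq_exp2l //; lia.
have le_2q : (2 * q ^ (2 * d) <= q ^ (2 * d).+1)%N by rewrite expnS leq_mul2r q_gt1 orbT.
have gap := @coef_locator_gap F S x T.
rewrite cardS in gap.
move=> i i_gt0 f_neq0; have [lt_i|gt_i|->] := ltngtP i (q ^ (2 * d)); last first.
- by exists d; rewrite expnM.
- by rewrite nth_default ?eqxx // size_locator cardS in f_neq0.
have [/existsP[j /eqP def_i]|Tt] := boolP (T (q ^ (2 * d) - i)%N).
  by exists j; have := lt_Qi j; lia.
case/negP: f_neq0; apply/eqP; rewrite -(subKn (ltnW lt_i)); apply: gap => //; last by lia.
- by move=> u lt_u; apply: code_low_moment.
(* If this moment vanished too, there would be as many vanishing moments as support points, forcing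
   [x] to be zero on its support. *)
- apply/negP => /eqP s_eq0; have /card_gt0P[a Sa] : (0 < #|S|)%N.
    by rewrite cardS expn_gt0 ltnW.
  have := Sa; rewrite inE => /negP; apply; apply/eqP.
  apply: (@vandermonde _ S) Sa => u; rewrite cardS => lt_u.
  have [->//|ne_u] := eqVneq u (q ^ (2 * d)).-1.
  by apply: code_low_moment => //; lia.
- by move=> t /existsP[j /eqP ->]; have := lt_Qi j; lia.
move=> t t_bd NTt; apply: code_moment => //; first by lia.
have lt_dm2 : (2 * d < 2 * m)%N by rewrite ltn_pmul2l.
have NTQ j : (j < d)%N -> t != (q ^ (2 * d) - (q ^ 2) ^ j)%N.
  by move=> lt_jd; apply: contraNN NTt => tE; apply/existsP; exists (Ordinal lt_jd).
have m_ge2 : (2 <= m * (q - 1))%N.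
  apply: (@leq_trans m); first exact: leq_ltn_trans d_gt0 lt_dm.
  by rewrite leq_pmulr // subn_gt0.
by have [|[wt_t oe_t]] := wtq_second_window q_gt1 lt_dm2 t_bd NTQ; [left | right].
Qed.

Lemma min_weight_coset x : code x -> hwt x = (q ^ (2 * d))%N ->
  exists (lam h : F) V, [/\ lam \in Fsub q, lam != 0,
    subspace_of_dim (Fsub (q ^ 2)) d V & forall g, x g = if g - h \in V then lam else 0].
Proof.
move=> Cx wt_x; have fQ := min_weight_locator Cx wt_x; set S := [set g | x g != 0] in fQ.
have cardS : #|S| = (q ^ (2 * d))%N by [].
have S_gt1 : (1 < #|S|)%N by rewrite cardS -(expn0 q) ltn_exp2l // muln_gt0.
(* The code constrains values to [Fsub q] only at nonzero coordinates, so the value [lam] is read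
   off at a nonzero point. *)
have [a Sa a_neq0] : exists2 a, a \in S & a != 0.
  have : (0 < #|S :\ 0%R|)%N.
    by move: S_gt1; rewrite (cardsD1 (0 : F) S); case: (0 \in S) => //= /ltnW.
  by case/card_gt0P => a; rewrite !inE => /andP[]; exists a; rewrite ?inE.
have [||V dimV defS] := @affine_locator_coset F q q_pchar d S a _ _ fQ Sa.
- by rewrite cardK.
- by rewrite cardK -expnM.
exists (x a), a, V; split=> //.
- by case: Cx => [[+ _] _]; apply.
- by rewrite inE in Sa.
move=> g; have -> : (g - a \in V) = (g \in S) by rewrite defS inE.
case: ifP => Sg; last by apply/eqP/negPn; move: Sg; rewrite inE => ->.
have [->//|ga] := eqVneq g a.
apply/eqP; rewrite -subr_eq0; apply/eqP.
(* The locator has constant derivative, so the low power sums over [S] vanish and [x - x a] has the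
   same vanishing moments as [x]. It is zero at [a], which leaves one point fewer, exactly what
   these moments can handle. *)
apply: (@vandermonde _ (S :\ a) (fun b => x b - x a)) => [u lt_u|]; last first.
  by rewrite !inE ga; move: Sg; rewrite inE.
have lt_uS : (u.+1 < #|S|)%N by have := cardsD1 a S; rewrite Sa; lia.
have -> : \sum_(b in S :\ a) (x b - x a) * b ^+ u = \sum_(b in S) (x b - x a) * b ^+ u.
  by rewrite [RHS](big_setD1 a) //= subrr mul0r add0r.
under eq_bigr do rewrite mulrBl.
rewrite sumrB code_low_moment -?cardS // -mulr_sumr.
by rewrite (power_sum_locator (deriv_affine_poly Q0 fQ) lt_uS) mulr0 subr0.
Qed.

End Code.

Theorem theorem5p7 (F : finFieldType) (p l m : nat) (alpha : F) (rho' : nat)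
    (I : pred nat) :
  prime p -> (0 < l)%N -> (0 < m)%N ->
  #|F| = ((p ^ l) ^ (2 * m))%N ->
  ((p ^ l) ^ (2 * m)).-1.-primitive_root alpha ->
  (2 * rho' <= 2 * m - 1)%N ->
  (forall k, I k -> Mr (p ^ l) m (2 * rho' * (p ^ l - 1)) k) ->
  I 0%N -> ~~ I 2%N ->
  forall x : F -> F,
    min_wt_codeword (p ^ l) m alpha (2 * rho' * (p ^ l - 1)) I x <->
    exists (lam h : F) (V : {set F}),
      [/\ lam \in Fsub (p ^ l), lam != 0,
          subspace_of_dim (Fsub ((p ^ l) ^ 2)) (m - rho') V &
          forall g : F, x g = if g - h \in V then lam else 0].
Proof.
move=> p_prime l_gt0 m_gt0 cardF alphaP le_rho _ I0 I2 x.
set q := (p ^ l)%N in cardF alphaP *.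
have pF : p \in [pchar F] by apply: card_finPcharP p_prime; rewrite cardF -expnM.
have q_gt1 : (1 < q)%N by rewrite -(expn0 p) ltn_exp2l ?prime_gt1.
have q_pchar : [pchar F].-nat q.
  by rewrite pnatX (eq_pnat _ (pcharf_eq pF)) pnat_id.
have q0 : q%:R = 0 :> F by rewrite natrX pcharf0 // expr0n gtn_eqF.
have lt_rho : (rho' < m)%N by lia.
have cardK : #|@Fsub F (q ^ 2)| = (q ^ 2)%N.
  apply: (@card_Fsub F _ m alpha) => //; last by rewrite -expnM.
  by rewrite -[1%N](exp1n 2) ltn_exp2r.
have Q_pchar : [pchar F].-nat (q ^ 2)%N by rewrite pnatX q_pchar.
have geq := code_weight_geq q_gt1 q_pchar cardF alphaP lt_rho I0 I2.
split=> [[Cx x_neq0 x_min]|[lam [h [V [Klam lam_neq0 dimV xE]]]]].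
  apply: (min_weight_coset q_gt1 q_pchar q0 cardF alphaP lt_rho I0 I2) => //.
  apply/eqP; rewrite eqn_leq geq // andbT.
  have [||V dimV] := @exists_subspace F _ Q_pchar (m - rho').
  - by rewrite cardK -[1%N](exp1n 2) ltn_exp2r.
  - by rewrite cardK cardF -expnM leq_exp2l // leq_mul2l leq_subr orbT.
  (* The indicator of a subspace is a codeword that attains the lower bound on the weight. *)
  pose y (g : F) : F := if g - 0 \in V then 1 else 0.
  have yE g : y g = if g - 0 \in V then 1 else 0 by [].
  have <- := hwt_coset q_gt1 q_pchar alphaP lt_rho dimV (oner_neq0 F) yE.
  apply: x_min.
    apply: (coset_in_code q_gt1 q_pchar q0 cardF alphaP lt_rho I0 dimV _ yE) => //.
    by rewrite inE expr1n.
  have [b [_ bV]] := dimV; exists 0; rewrite /y subr0 ifT ?oner_neq0 //.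
  apply/bV; exists (fun=> 0); split=> [_|]; first exact: Fsub0.
  by rewrite big1 // => i _; rewrite mul0r.
have wt_x := hwt_coset q_gt1 q_pchar alphaP lt_rho dimV lam_neq0 xE.
split; first exact: (coset_in_code q_gt1 q_pchar q0 cardF alphaP lt_rho I0 dimV Klam xE).
  have : (0 < hwt x)%N by rewrite wt_x expn_gt0 ltnW.
  by case/card_gt0P => g; rewrite inE; exists g.
by move=> y Cy y_neq0; rewrite wt_x geq.
Qed.
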